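(* Let $\nu$ be the uniform distribution on the interval $[\frac25,\frac35]$. Then, for $n\ge1$, the set $\{\frac25+\frac{2i-1}{10n}:1\le i\le n\}$ is a unique optimal set of $n$-means for $\nu$, with quantization error $V_n(\nu)=\frac{W}{n^2}$, where $W=\frac1{300}$ is the variance of $\nu$. Moreover, the quantization dimension $D(\nu)$ of $\nu$ is one.
   Context: For a Borel probability measure $\mu$ on $\mathbb R$, $V_n(\mu)=\inf\{\int\min_{a\in\alpha}(x-a)^2\,d\mu(x):\alpha\subseteq\mathbb R,\ 1\le\mathrm{card}(\alpha)\le n\}$ is the $n$th quantization error (of order 2), and a set $\alpha$ with at most $n$ elements attaining this infimum is an optimal set of $n$-means for $\mu$. The quantization dimension is $D(\mu)=\lim_{n\to\infty}\frac{2\log n}{-\log V_n(\mu)}$, when the limit exists. *)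

(* Defs.v *)
From HB Require Import structures.
From mathcomp Require Import all_boot all_order all_algebra.
From mathcomp Require Import lra.
From mathcomp Require Import all_classical all_reals all_analysis.

Set Implicit Arguments.
Unset Strict Implicit.
Unset Printing Implicit Defensive.

Import Order.TTheory GRing.Theory Num.Theory.
Import numFieldNormedType.Exports.

Local Open Scope classical_set_scope.
Local Open Scope ring_scope.

(* On a nonempty finite set [alpha] the infimum is attained, so this is the
   minimum; only such sets are used below. *)
Definition sqdist {R : realType} (alpha : set R) (x : R) : R :=
  inf [set (x - a) ^+ 2 | a in alpha].

Definition distortion {R : realType} (mu : probability (measurableTypeR R) R)
    (alpha : set R) : \bar R :=
  (\int[mu]_x (sqdist alpha x)%:E)%E.

Definition codebook {R : realType} (n : nat) (alpha : set R) : Prop :=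
  alpha !=set0 /\ (alpha #<= `I_n)%card.

Definition quantization_error {R : realType}
    (mu : probability (measurableTypeR R) R) (n : nat) : \bar R :=
  ereal_inf [set distortion mu alpha | alpha in codebook n].

Definition optimal_n_means {R : realType}
    (mu : probability (measurableTypeR R) R) (n : nat) (alpha : set R) : Prop :=
  codebook n alpha /\ distortion mu alpha = quantization_error mu n.

(* The quantization dimension exists and equals [d].  When [V_n] is [0] or [+oo]
   the quotient is [0], by [fine +oo = 0], [ln 0 = 0] and [0^-1 = 0]; this agrees
   with the conventions [log 0 = -oo], [log +oo = +oo] and division by [+-oo]. *)
Definition is_quantization_dimension {R : realType}
    (mu : probability (measurableTypeR R) R) (d : R) : Prop :=
  (2 * ln n%:R) / (- ln (fine (quantization_error mu n))) @[n --> \oo] --> d.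

Lemma lt_2_5_3_5 (R : realType) : (2 / 5 : R) < 3 / 5.
Proof. lra. Qed.

Definition unif_2_5_3_5 (R : realType) : probability (measurableTypeR R) R :=
  uniform_prob (lt_2_5_3_5 R).

(* Main.v *)
Require Import Defs.
From HB Require Import structures.
From mathcomp Require Import all_boot all_order all_algebra.
From mathcomp Require Import ring lra.
From mathcomp Require Import all_classical all_reals all_analysis.
From mathcomp Require Import measurable_realfun.
Import Order.TTheory GRing.Theory Num.Theory.
Import numFieldNormedType.Exports.
Local Open Scope classical_set_scope.
Local Open Scope ring_scope.

(** Let the interval have length [L] and put [t = L / (2 n)], half the length of
    one of [n] equal cells.  For a finite set [alpha] with squared distance
    function [d2] and every [x],

      t^2 <= d2 x + \sum_(a in alpha) max 0 (t^2 - (x - a)^2),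

    because the summand of a nearest [a] alone makes up the difference.  Over
    the whole line each summand has integral [4 t^3 / 3], so integrating over
    the interval bounds the integral of [d2] from below by
    [L t^2 - n (4 t^3 / 3) = L t^2 / 3].  After division by [L] this is
    [L^2 / (12 n^2)], the announced error ([integral_sqdist_ge]).

    When every point of the interval is within [t] of [alpha], one also has
    [d2 x <= \sum_(a | |x - a| <= t) (x - a)^2], and each of these terms has
    integral [2 t^3 / 3], so the bound is attained ([integral_sqdist_le]); the
    cell midpoints are such an [alpha].  When some point is farther than [t]
    from [alpha], [d2] exceeds [t^2] by a fixed amount near that point, and the
    lower bound is strict ([integral_sqdist_gt]).  So the optimal sets are
    exactly those for which the [n] intervals of radius [t] cover the interval.
    These intervals have total length [L], so they can leave no gap and have no
    slack, which forces their centres to be the midpoints ([cover_nth_eq]).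

    For the dimension, [V_n = C / n^2] gives
    [2 ln n / - ln V_n = 1 + ln C / (2 ln n - ln C)], which tends to 1. *)

(** * Squared distance to a finite set *)

Lemma sqdist_le (R : realType) (alpha : set R) (a x : R) :
  alpha a -> sqdist alpha x <= (x - a) ^+ 2.
Proof.
move=> aa; apply: ge_inf; last by exists a.
by exists 0 => _ [b _ <-]; exact: sqr_ge0.
Qed.

Lemma le_sqdist (R : realType) (alpha : set R) (r x : R) : alpha !=set0 ->
  (forall a, alpha a -> r <= (x - a) ^+ 2) -> r <= sqdist alpha x.
Proof.
move=> [a aa] ra; apply: lb_le_inf; first by exists ((x - a) ^+ 2), a.
by move=> _ [b bb <-]; exact: ra.
Qed.

Lemma sqdist_ge0 (R : realType) (alpha : set R) (x : R) :
  alpha !=set0 -> 0 <= sqdist alpha x.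
Proof. by move=> a0; apply: le_sqdist => // a _; exact: sqr_ge0. Qed.

Lemma nonempty_seq (R : realType) (s : seq R) : s != [::] -> [set` s] !=set0.
Proof. by case: s => // a s _; exists a => /=; exact: mem_head. Qed.

(** Adding one point at a time turns the infimum into a finite minimum, which
    gives its measurability. *)
Lemma sqdist_cons (R : realType) (a b : R) (s : seq R) (x : R) :
  sqdist [set` a :: b :: s] x =
  Num.min ((x - a) ^+ 2) (sqdist [set` b :: s] x).
Proof.
apply/le_anti/andP; split.
  rewrite le_min sqdist_le ?inE//=; last exact: mem_head.
  apply: le_sqdist => [|c /= cs]; first exact: nonempty_seq.
  by apply: sqdist_le; rewrite /= in_cons cs orbT.
apply: le_sqdist => [|c /=]; first exact: nonempty_seq.
rewrite in_cons => /orP[/eqP ->|cs]; first by rewrite ge_min lexx.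
by rewrite ge_min sqdist_le ?orbT.
Qed.

Lemma measurable_sqdist (R : realType) (s : seq R) : s != [::] ->
  measurable_fun setT (sqdist [set` s] : measurableTypeR R -> R).
Proof.
have mq c : measurable_fun setT (fun x : measurableTypeR R => (x - c) ^+ 2 : R).
  by apply: measurable_funX; exact: measurable_funB.
elim: s => // a [|b s] IH _.
  rewrite (_ : sqdist _ = fun x => (x - a) ^+ 2)//; apply/funext => x.
  apply/le_anti/andP; split; first by apply: sqdist_le; exact: mem_head.
  apply: le_sqdist => [|c /=]; first exact: nonempty_seq.
  by rewrite inE => /eqP ->.
rewrite (_ : sqdist _ = (fun x => (x - a) ^+ 2) \min sqdist [set` b :: s]).
  by apply: measurable_minr => //; exact: IH.
by apply/funext => x; rewrite sqdist_cons.
Qed.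

(** Sums run over [s] and the covering argument reads its entries from left to
    right, whence a sorted list rather than a finite set. *)
Lemma codebook_seq (R : realType) (n : nat) (alpha : set R) :
  codebook n alpha -> exists s : seq R,
    [/\ alpha = [set` s], sorted <=%O s, s != [::] & (size s <= n)%N].
Proof.
move=> [a0 an]; have /finite_seqP[s0 sE] := card_le_finite an (finite_II n).
pose s := sort <=%O (undup s0).
have ss : alpha = [set` s].
  by rewrite sE; apply/seteqP; split=> x /=; rewrite mem_sort mem_undup.
exists s; split=> //.
- exact: sort_le_sorted.
- by case: s ss => // aE; case: a0 => x; rewrite aE.
rewrite -card_le_II; apply: card_le_trans an.
have us : uniq s by rewrite sort_uniq undup_uniq.
have inj : {in `I_(size s) &, injective (nth 0 s)}.
  by move=> i j /[!inE]/= si sj /eqP; rewrite nth_uniq// => /eqP.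
rewrite -(card_le_eql (inj_card_eq inj)).
by apply: subset_card_le => _ [i /= si <-]; rewrite ss /= mem_nth.
Qed.

(** * Covering an interval by short intervals *)

(** Otherwise, by induction, every entry before the [k]-th reaches at most [c + 2 k t], every
    later one starts strictly to the right of that point, and a point slightly
    to its right is left uncovered.  The default value [z] is taken larger than
    the bound, so that the conclusion also gives [k < size s]. *)
Lemma cover_nth_le (R : realType) (s : seq R) (t c z : R) (n k : nat) :
  0 < t -> sorted <=%O s ->
  (forall x, c <= x <= c + 2 * n%:R * t ->
     exists2 a, a \in s & `|x - a| <= t) ->
  (k < n)%N -> c + (2 * k%:R + 1) * t < z ->
  nth z s k <= c + (2 * k%:R + 1) * t.
Proof.
move=> t0 ss cov; elim/ltn_ind: k z => k IH z kn hz; rewrite leNgt.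
apply/negP; set y := nth z s k => lz.
have nt (i j : nat) : (i < j)%N -> 2 * i%:R * t + 2 * t <= 2 * j%:R * t.
  by rewrite -(ler_nat R) -natr1 => ij; nra.
(* [c + 2 k t + d] is uncovered: beyond the reach of the earlier entries and
   more than [t] short of [y]; [d <= t] keeps it within the interval *)
pose d := Num.min t ((y - c - (2 * k%:R + 1) * t) / 2).
have d0 : 0 < d by rewrite lt_min t0/=; lra.
have [dt dy] : d <= t /\ d <= (y - c - (2 * k%:R + 1) * t) / 2.
  by rewrite /d !ge_min !lexx orbT.
have kt : 0 <= 2 * k%:R * t by rewrite !mulr_ge0// ltW.
have [|a aS] := cov (c + 2 * k%:R * t + d).
  by have := nt _ _ kn; lra.
have ia : (index a s < size s)%N by rewrite index_mem.
rewrite -(nth_index z aS) ler_distl => /andP[h1 h2].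
have [ik|ki] := ltnP (index a s) k.
  have := nt _ _ ik; have := IH _ ik z (ltn_trans ik kn).
  by lra.
have : y <= nth z s (index a s).
  apply: (sorted_leq_nth le_trans le_refl z ss) => //.
  by rewrite inE (leq_ltn_trans ki).
lra.
Qed.

Definition midpoints {R : realType} (c t : R) (n : nat) : seq R :=
  [seq c + (2 * k%:R + 1) * t | k <- iota 0 n].

(** The intervals have total length at most that of the interval they cover.
    The upper bounds on the entries come from [cover_nth_le]; the lower bounds
    come from the same lemma after reflection [x -> - x]. *)
Lemma cover_nth_eq (R : realType) (s : seq R) (t c : R) (n : nat) :
  0 < t -> sorted <=%O s -> (size s <= n)%N ->
  (forall x, c <= x <= c + 2 * n%:R * t ->
     exists2 a, a \in s & `|x - a| <= t) ->
  s = midpoints c t n.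
Proof.
move=> t0 ss sn cov.
have up k : (k < n)%N -> (k < size s)%N /\ nth 0 s k <= c + (2 * k%:R + 1) * t.
  move=> kn; pose z := c + (2 * k%:R + 1) * t + 1.
  have := @cover_nth_le R s t c z n k t0 ss cov kn.
  rewrite ltrDl ltr01 => /(_ isT).
  have [ks|sk] := ltnP k (size s); last by rewrite nth_default// /z; lra.
  by rewrite (set_nth_default 0).
have sz : size s = n.
  apply/eqP; rewrite eqn_leq sn/=.
  by case: {sn cov} n up => // n /(_ n (leqnn _))[].
pose s' := [seq - a | a <- rev s].
have ss' : sorted <=%O s'.
  rewrite /s' sorted_map rev_sorted.
  by apply: sub_sorted ss => x y /= xy; rewrite lerN2.
have cov' x : - (c + 2 * n%:R * t) <= x <= - (c + 2 * n%:R * t) + 2 * n%:R * t ->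
    exists2 a, a \in s' & `|x - a| <= t.
  move=> hx; have [|a aS ha] := cov (- x); first by lra.
  exists (- a); last by rewrite opprK -normrN opprD.
  by apply/mapP; exists a => //; rewrite mem_rev.
apply: (@eq_from_nth _ 0) => [|k]; first by rewrite size_map size_iota.
rewrite sz => kn; rewrite (nth_map 0%N) ?size_iota// nth_iota// add0n.
apply/le_anti/andP; split; first exact: (up k kn).2.
have kn' : (n - k.+1 < n)%N by rewrite ltn_subrL (leq_ltn_trans _ kn).
have := @cover_nth_le R s' t _ (- (c + 2 * n%:R * t) +
  (2 * (n - k.+1)%:R + 1) * t + 1) n _ t0 ss' cov' kn'.
rewrite ltrDl ltr01 => /(_ isT).
rewrite (nth_map 0) ?size_rev ?sz// nth_rev ?sz// subnSK// subKn ?(ltnW kn)//.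
rewrite natrB// -natr1; lra.
Qed.

(** * Integrals of windowed quadratics *)

(** The only integral computed from an antiderivative: with suitable [u], [v]
    and [w] it gives the mean, the variance and both window integrals. *)
Lemma integral_quadratic (R : realType) (a t u v w : R) : 0 < t ->
  (\int[lebesgue_measure]_(x in `[(a - t)%R, (a + t)%R])
     (u + v * (x - a) + w * (x - a) ^+ 2)%:E =
   (2 * u * t + 2 * w * t ^+ 3 / 3)%:E)%E.
Proof.
move=> t0; pose F (x : R) : R :=
  u * (x - a) + v / 2 * (x - a) ^+ 2 + w / 3 * (x - a) ^+ 3.
have dF (x : R) : is_derive x 1 F (u + v * (x - a) + w * (x - a) ^+ 2).
  rewrite /F; apply: is_derive_eq.
  by rewrite /GRing.scale/= !expr2 ; lra.
have dG (x : R) : is_derive x 1 (fun x => u + v * (x - a) + w * (x - a) ^+ 2)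
    (v + 2 * w * (x - a)).
  by apply: is_derive_eq; rewrite /GRing.scale/=; lra.
have cvg_of_derive (g g' : R -> R) : (forall x : R, is_derive x 1 g (g' x)) ->
    continuous g.
  by move=> dg x; apply/differentiable_continuous/derivable1_diffP; have [] := dg x.
rewrite (@continuous_FTC2 _ _ F); first 1 last.
- by lra.
- by apply: continuous_subspaceT; exact: cvg_of_derive dG.
- split.
  + by move=> x _; have [] := dF x.
  + by apply: cvg_at_right_filter; exact: (cvg_of_derive _ _ dF).
  + by apply: cvg_at_left_filter; exact: (cvg_of_derive _ _ dF).
- by move=> x _; rewrite derive1E; have [_ ->] := dF x.
by rewrite -EFinB /F; congr EFin; lra.
Qed.

Definition windowed {R : realType} (t : R) (f : R -> R) (a x : R) : R :=
  if `|x - a| <= t then f (x - a) else 0.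

Lemma windowed_ge0 (R : realType) (t : R) (f : R -> R) (a x : R) :
  (forall y, `|y| <= t -> 0 <= f y) -> 0 <= windowed t f a x.
Proof. by move=> f0; rewrite /windowed; case: ifP => // /f0. Qed.

Lemma windowed_patch (R : realType) (t : R) (f : R -> R) (a : R) :
  windowed t f a = (fun x => f (x - a)) \_ `[a - t, a + t].
Proof.
by apply/funext => x; rewrite patchE /windowed mem_setE in_itv/= ler_distl.
Qed.

Lemma measurable_windowed (R : realType) (t : R) (f : R -> R) (a : R) :
  measurable_fun setT (f : measurableTypeR R -> R) ->
  measurable_fun setT (windowed t f a : measurableTypeR R -> R).
Proof.
move=> mf; rewrite windowed_patch.
apply/(measurable_restrictT _ (measurable_itv _)).
apply: measurable_funTS; apply: (measurableT_comp mf).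
exact: measurable_funB.
Qed.

Lemma integral_windowed_le (R : realType) (D : set (measurableTypeR R))
    (t : R) (f : R -> R) (a : R) : measurable D ->
  measurable_fun setT (f : measurableTypeR R -> R) ->
  (forall y, `|y| <= t -> 0 <= f y) ->
  (\int[lebesgue_measure]_(x in D) (windowed t f a x)%:E <=
   \int[lebesgue_measure]_(x in `[(a - t)%R, (a + t)%R]) (f (x - a))%:E)%E.
Proof.
move=> mD mf f0; rewrite [leRHS]integral_mkcond.
under [leRHS]eq_integral => x _.
  have -> : ((fun x0 => (f (x0 - a))%:E) \_ `[(a - t)%R, (a + t)%R]) x =
      (windowed t f a x)%:E by rewrite windowed_patch !patchE; case: ifP.
  over.
apply: ge0_subset_integral => //.
  by apply/measurable_EFinP; exact: measurable_windowed.
by move=> x _; rewrite lee_fin windowed_ge0.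
Qed.

(** A window may stick out of [D], hence only an inequality. *)
Lemma integral_sum_windowed_le (R : realType) (D : set (measurableTypeR R))
    (t u w : R) (s : seq R) : 0 < t -> measurable D ->
  (forall y, `|y| <= t -> 0 <= u + w * y ^+ 2) ->
  (\int[lebesgue_measure]_(x in D)
     (\sum_(a <- s) windowed t (fun y => u + w * y ^+ 2) a x)%:E <=
   ((size s)%:R * (2 * u * t + 2 * w * t ^+ 3 / 3))%:E)%E.
Proof.
move=> t0 mD f0; set f : R -> R := (fun y => u + w * y ^+ 2) in f0 *.
have mf : measurable_fun setT (f : measurableTypeR R -> R).
  apply: measurable_funD => //; apply: measurable_funM => //.
under eq_integral do rewrite -sumEFin.
rewrite ge0_integral_sum//; first last.
- by move=> a x _; rewrite lee_fin windowed_ge0.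
- move=> a; apply: measurable_funTS; apply/measurable_EFinP.
  exact: measurable_windowed.
set c := _ + _ / 3.
have -> : (size s)%:R * c = \sum_(a <- s) c.
  by rewrite big_const_seq count_predT iter_addr_0 mulr_natl.
rewrite -sumEFin; apply: lee_sum => a _.
apply: le_trans (integral_windowed_le _ _ _ _ a mD mf f0) _.
rewrite -(@integral_quadratic _ a t u 0 w)//.
by under [leRHS]eq_integral do rewrite mul0r addr0.
Qed.

(** * Bounds on the integral of the squared distance *)

Lemma sqr_le_of_norm (R : realType) (t y : R) : `|y| <= t -> y ^+ 2 <= t ^+ 2.
Proof. by rewrite ler_norml => /andP[? ?]; nra. Qed.

Lemma sqr_ge_of_norm (R : realType) (t y : R) :
  0 <= t -> t <= `|y| -> t ^+ 2 <= y ^+ 2.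
Proof. by move=> t0; rewrite ler_normr => /orP[?|?]; nra. Qed.

(** The summand at [a] is the positive part of [t^2 - (x - a)^2], so for each
    [a] the sum is at least [t^2 - (x - a)^2]. *)
Lemma sqr_le_sqdist_sum (R : realType) (s : seq R) (t x : R) :
  0 < t -> s != [::] ->
  t ^+ 2 <= sqdist [set` s] x
            + \sum_(a <- s) windowed t (fun y => t ^+ 2 + (-1) * y ^+ 2) a x.
Proof.
move=> t0 s0; set g := windowed _ _; rewrite -lerBlDr.
have g0 a : 0 <= g a x.
  by apply: windowed_ge0 => y /sqr_le_of_norm; lra.
apply: le_sqdist => [|a /= aS].
  exact: nonempty_seq.
rewrite (big_rem a)//= lerBlDr.
have : 0 <= \sum_(b <- rem a s) g b x by exact: sumr_ge0.
suff : t ^+ 2 - (x - a) ^+ 2 <= g a x by lra.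
rewrite /g /windowed; case: (leP `|x - a| t) => [_|ta]; first by lra.
by have := sqr_ge_of_norm _ _ _ (ltW t0) (ltW ta); lra.
Qed.

Lemma sqdist_le_sum (R : realType) (s : seq R) (t x : R) :
  (exists2 a, a \in s & `|x - a| <= t) ->
  sqdist [set` s] x <=
  \sum_(a <- s) windowed t (fun y => 0 + 1 * y ^+ 2) a x.
Proof.
move=> [a aS xa]; rewrite (big_rem a)//= {1}/windowed xa.
rewrite add0r mul1r -[leLHS]addr0 lerD//; first exact: sqdist_le.
apply: sumr_ge0 => b _; apply: windowed_ge0 => y _.
by rewrite add0r mul1r sqr_ge0.
Qed.

(** Integrated form of [sqr_le_sqdist_sum], with a gain [e] wherever [sqdist]
    is already above [t^2 + e].  The gain is on an open interval so that [p = q]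
    gives the plain lower bound with no condition left to check. *)
Lemma integral_sqdist_ge (R : realType) (s : seq R) (n : nat) (c t p q e : R) :
  0 < t -> s != [::] -> (size s <= n)%N -> 0 <= e ->
  c <= p -> p <= q -> q <= c + 2 * n%:R * t ->
  (forall x, p < x < q -> t ^+ 2 + e <= sqdist [set` s] x) ->
  ((2 * n%:R * t ^+ 3 / 3 + e * (q - p))%:E <=
   \int[lebesgue_measure]_(x in `[c, (c + 2 * n%:R * t)%R])
     (sqdist [set` s] x)%:E)%E.
Proof.
move=> t0 s0 sn e0 cp pq qd far.
set D := `[c, _]%classic.
have mD : measurable (D : set (measurableTypeR R)) by exact: measurable_itv.
have mJ : measurable (`]p, q[%classic : set (measurableTypeR R)).
  exact: measurable_itv.
have nt : 0 <= 2 * n%:R * t by rewrite !mulr_ge0// ltW.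
pose g a x := windowed t (fun y => t ^+ 2 + (-1) * y ^+ 2) a x.
have h0 y : `|y| <= t -> 0 <= t ^+ 2 + (-1) * y ^+ 2.
  by move=> /sqr_le_of_norm; lra.
have g0 a x : 0 <= g a x by apply: windowed_ge0.
have mh : measurable_fun setT
    (fun y : measurableTypeR R => t ^+ 2 + (-1) * y ^+ 2 : R).
  by apply: measurable_funD => //; apply: measurable_funM.
have mg : measurable_fun setT
    (fun x : measurableTypeR R => \sum_(a <- s) g a x : R).
  by apply: measurable_sum => a; exact: measurable_windowed.
have sne : [set` s] !=set0 by exact: nonempty_seq.
have ms : measurable_fun setT (sqdist [set` s] : measurableTypeR R -> R).
  exact: measurable_sqdist.
have le1 : (\int[lebesgue_measure]_(x in D) (t ^+ 2 + e * \1_`]p, q[ x)%:E <=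
   \int[lebesgue_measure]_(x in D)
     ((sqdist [set` s] x)%:E + (\sum_(a <- s) g a x)%:E))%E.
  apply: ge0_le_integral => //.
  - by move=> x _; rewrite lee_fin addr_ge0 ?sqr_ge0// mulr_ge0.
  - apply: measurable_funTS; apply/measurable_EFinP.
    by apply: measurable_funD => //; apply: measurable_funM => //.
  - by apply: measurable_funTS; apply: emeasurable_funD; exact/measurable_EFinP.
  - move=> x _; rewrite -EFinD lee_fin indicE.
    have [xJ|_] := boolP (x \in _).
      rewrite mulr1; apply: le_trans (far x _) _; last by rewrite lerDl sumr_ge0.
      by move: xJ; rewrite inE/= in_itv.
    by rewrite mulr0 addr0; exact: sqr_le_sqdist_sum.
have muD : lebesgue_measure D = (2 * n%:R * t)%:E :> \bar R.
  rewrite lebesgue_measure_itv/= lte_fin ltrDl.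
  case: ltP => [_|n0]; first by rewrite -EFinD addrAC subrr add0r.
  by congr EFin; apply/le_anti; rewrite n0 nt.
have muJ : lebesgue_measure (`]p, q[%classic : set R) = (q - p)%:E :> \bar R.
  rewrite lebesgue_measure_itv/= lte_fin; case: ltP => [_|qp]//.
  by congr EFin; lra.
have lhsE : (\int[lebesgue_measure]_(x in D) (t ^+ 2 + e * \1_`]p, q[ x)%:E =
    (t ^+ 2 * (2 * n%:R * t) + e * (q - p))%:E)%E.
  under eq_integral do rewrite EFinD.
  rewrite ge0_integralD//; first last.
  - by apply: measurable_funTS; apply/measurable_EFinP; apply: measurable_funM.
  - by move=> x _; rewrite lee_fin mulr_ge0.
  - by move=> x _; rewrite lee_fin sqr_ge0.
  rewrite integral_cst// [X in (_ * X + _)%E]muD.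
  under eq_integral do rewrite EFinM.
  rewrite ge0_integralZl_EFin//; last first.
    by apply: measurable_funTS; apply/measurable_EFinP.
  rewrite integral_indic// setIidl; last first.
    move=> x; rewrite /D/= !in_itv/= => /andP[px xq].
    by rewrite (le_trans cp (ltW px)) (le_trans (ltW xq) qd).
  by rewrite [X in (_ + _ * X)%E]muJ -!EFinM -EFinD.
rewrite lhsE ge0_integralD// in le1; first last.
- by apply: measurable_funTS; exact/measurable_EFinP.
- by move=> x _; rewrite lee_fin sumr_ge0.
- by apply: measurable_funTS; exact/measurable_EFinP.
- by move=> x _; rewrite lee_fin sqdist_ge0.
have le2 := @integral_sum_windowed_le R D t (t ^+ 2) (-1) s t0 mD h0.
have := le_trans le1 (leeD2l _ le2); rewrite -leeBlDr// -EFinB.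
apply: le_trans; rewrite lee_fin.
have : (size s)%:R <= n%:R :> R by rewrite ler_nat.
have : 0 < t ^+ 3 by rewrite exprn_gt0.
nra.
Qed.

(** Finitely many points stay at distance at least some [r > t] from the
    uncovered [x0], so [sqdist] is above [((r + t) / 2)^2] near [x0]. *)
Lemma integral_sqdist_gt (R : realType) (s : seq R) (n : nat) (c t x0 : R) :
  0 < t -> s != [::] -> (size s <= n)%N ->
  c <= x0 <= c + 2 * n%:R * t -> (forall a, a \in s -> t < `|x0 - a|) ->
  ((2 * n%:R * t ^+ 3 / 3)%:E <
   \int[lebesgue_measure]_(x in `[c, (c + 2 * n%:R * t)%R])
     (sqdist [set` s] x)%:E)%E.
Proof.
move=> t0 s0 sn /andP[cx xd] far.
have [r tr sr] : exists2 r, t < r & forall a, a \in s -> r <= `|x0 - a|.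
  elim: s far {s0 sn} => [|a s IH] far; first by exists (t + 1) => //; lra.
  have [|r tr sr] := IH; first by move=> b bs; apply: far; rewrite inE bs orbT.
  exists (Num.min r `|x0 - a|); first by rewrite lt_min tr far ?mem_head.
  move=> b; rewrite inE => /orP[/eqP ->|/sr rb]; first by rewrite ge_min lexx orbT.
  by rewrite ge_min rb.
have n0 : 1 <= n%:R :> R.
  by rewrite ler1n; case: s s0 sn {far sr} => // a s _; exact: leq_ltn_trans.
pose d := Num.min ((r - t) / 2) t.
have d0 : 0 < d by rewrite lt_min t0 andbT; lra.
have [dr dt] : d <= (r - t) / 2 /\ d <= t by rewrite /d !ge_min !lexx orbT.
pose e := ((r + t) / 2) ^+ 2 - t ^+ 2.
have e0 : 0 < e by rewrite /e; nra.
have farJ x : `|x - x0| <= d -> t ^+ 2 + e <= sqdist [set` s] x.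
  move=> xx0; rewrite /e addrC subrK; apply: le_sqdist => [|a /= aS].
    exact: nonempty_seq.
  apply: sqr_ge_of_norm; first by lra.
  have := sr _ aS; have := ler_distD x x0 a; rewrite (distrC x0 x); lra.
suff [p [q [cp pq qd far']]] : exists p q, [/\ c <= p, p < q,
    q <= c + 2 * n%:R * t & forall x, p < x < q -> t ^+ 2 + e <= sqdist [set` s] x].
  apply: lt_le_trans (integral_sqdist_ge _ _ _ _ _ _ _ _
    t0 s0 sn (ltW e0) cp (ltW pq) qd far').
  by rewrite lte_fin ltrDl mulr_gt0// subr_gt0.
(* the interval is at least [2 t] long and [d <= t], so one side of [x0] has room *)
have nt : t <= n%:R * t by rewrite ler_peMl// ltW.
have [h|h] := lerP (x0 + d) (c + 2 * n%:R * t).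
  exists x0, (x0 + d); split => //; first by lra.
  by move=> x /andP[? ?]; apply: farJ; rewrite ler_norml; lra.
exists (x0 - d), x0; split => //; [lra|lra|].
by move=> x /andP[? ?]; apply: farJ; rewrite ler_norml; lra.
Qed.

Lemma integral_sqdist_le (R : realType) (s : seq R) (n : nat) (c t : R) :
  0 < t -> s != [::] -> (size s <= n)%N ->
  (forall x, c <= x <= c + 2 * n%:R * t ->
     exists2 a, a \in s & `|x - a| <= t) ->
  (\int[lebesgue_measure]_(x in `[c, (c + 2 * n%:R * t)%R])
     (sqdist [set` s] x)%:E <= (2 * n%:R * t ^+ 3 / 3)%:E)%E.
Proof.
move=> t0 s0 sn cov; set D := `[c, _]%classic.
have mD : measurable (D : set (measurableTypeR R)) by exact: measurable_itv.
have h0 (y : R) : `|y| <= t -> 0 <= 0 + 1 * y ^+ 2.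
  by move=> _; rewrite add0r mul1r sqr_ge0.
(* the right-hand side of [integral_sum_windowed_le] with [u = 0], [w = 1] *)
apply: (@le_trans _ _ ((size s)%:R * (2 * 0 * t + 2 * 1 * t ^+ 3 / 3))%:E).
  apply: le_trans (integral_sum_windowed_le _ _ _ _ _ s t0 mD h0).
  apply: ge0_le_integral => //.
  - move=> x _; rewrite lee_fin sqdist_ge0//.
    exact: nonempty_seq.
  - apply: measurable_funTS; apply/measurable_EFinP.
    exact: measurable_sqdist.
  - apply: measurable_funTS; apply/measurable_EFinP; apply: measurable_sum => a.
    by apply: measurable_windowed; apply: measurable_funD => //; apply: measurable_funM.
  - move=> x; rewrite /D/= in_itv/= => xD; rewrite lee_fin.
    by apply: sqdist_le_sum; exact: cov.
rewrite lee_fin.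
have : (size s)%:R <= n%:R :> R by rewrite ler_nat.
have : 0 < t ^+ 3 by rewrite exprn_gt0.
nra.
Qed.

(** * Uniform distributions *)

Lemma midpoints_cover (R : realType) (c t x : R) (n : nat) : (0 < n)%N ->
  c <= x <= c + 2 * n%:R * t ->
  exists2 a, a \in midpoints c t n & `|x - a| <= t.
Proof.
case: n => // n _ /andP[cx xd].
have [k kn kx] : exists2 k, (k < n.+1)%N &
    `|x - (c + (2 * k%:R + 1) * t)| <= t.
  elim: n xd => [|n IH] xd.
    by exists 0%N => //; rewrite ler_norml; lra.
  have [/IH[k kn kx]|nx] := lerP x (c + 2 * n.+1%:R * t).
    by exists k => //; exact: ltnW.
  exists n.+1 => //; rewrite ler_norml; move: xd nx; rewrite -(natr1 n.+1); lra.
exists (c + (2 * k%:R + 1) * t) => //.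
by apply/mapP; exists k => //; rewrite mem_iota.
Qed.

Lemma codebook_midpoints (R : realType) (c t : R) (n : nat) : (0 < n)%N ->
  codebook n [set` midpoints c t n].
Proof.
move=> n0; split.
  by apply: nonempty_seq; rewrite -size_eq0 size_map size_iota -lt0n.
have -> : [set` midpoints c t n] = (fun k => c + (2 * k%:R + 1) * t) @` `I_n.
  apply/seteqP; split => [x /= /mapP[k]|x /= [k kn <-]].
    by rewrite mem_iota => /= kn ->; exists k.
  by apply/mapP; exists k => //; rewrite mem_iota.
exact: card_image_le.
Qed.

Lemma distortion_uniform (R : realType) (a b : R) (ab : a < b) (s : seq R) :
  s != [::] ->
  distortion (uniform_prob ab) [set` s] =
  ((b - a)^-1%:E *
   \int[lebesgue_measure]_(x in `[a, b]) (sqdist [set` s] x)%:E)%E.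
Proof.
move=> s0; rewrite /distortion integral_uniform//.
  by apply/measurable_EFinP; exact: measurable_sqdist.
by move=> x; rewrite lee_fin sqdist_ge0//; exact: nonempty_seq.
Qed.

(** Covering the interval by radius-[t] windows is what decides equality: it is
    sufficient by [integral_sqdist_le], necessary by [integral_sqdist_gt], and
    satisfied by the midpoints only. *)
Lemma distortion_uniform_min (R : realType) (a b : R) (ab : a < b) (n : nat)
    (alpha : set R) : (0 < n)%N -> codebook n alpha ->
  let m := midpoints a ((b - a) / (2 * n%:R)) n in
  let v := ((b - a) ^+ 2 / 12 / n%:R ^+ 2)%:E in
  (v <= distortion (uniform_prob ab) alpha)%E /\
  (distortion (uniform_prob ab) alpha = v <-> alpha = [set` m]).
Proof.
move=> n0 ca m v; set t := (b - a) / (2 * n%:R) in m *.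
have n0R : 0 < n%:R :> R by rewrite ltr0n.
have L0 : 0 < b - a by rewrite subr_gt0.
have t0 : 0 < t by rewrite divr_gt0// mulr_gt0.
have bE : b = a + 2 * n%:R * t by rewrite /t; field; rewrite gt_eqF.
have vE : v = ((b - a)^-1%:E * (2 * n%:R * t ^+ 3 / 3)%:E)%E.
  by rewrite -EFinM /v /t; congr EFin; field; rewrite !gt_eqF.
have Li0 : (0 < (b - a)^-1%:E :> \bar R)%E by rewrite lte_fin invr_gt0.
have Dv s : s != [::] -> (size s <= n)%N ->
    (v <= distortion (uniform_prob ab) [set` s])%E.
  move=> s0 sn; rewrite distortion_uniform// vE lee_pmul2l// [X in `[a, X]]bE.
  have := @integral_sqdist_ge R s n a t a a 0 t0 s0 sn (lexx _) (lexx _) (lexx _).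
  rewrite mul0r !addr0; apply=> [|x]; last by lra.
  by rewrite -bE ltW.
have [m0 sm] : m != [::] /\ (size m <= n)%N.
  by split; [rewrite -size_eq0 size_map size_iota -lt0n|rewrite size_map size_iota].
have [s [-> ss s0 sn]] := codebook_seq _ _ _ ca.
split; first exact: Dv.
split=> [Ds|->]; last first.
  apply/le_anti/andP; split; last exact: Dv.
  rewrite distortion_uniform// vE lee_pmul2l// [X in `[a, X]]bE.
  by apply: integral_sqdist_le => // x; exact: midpoints_cover.
suff -> : s = m by []; apply: cover_nth_eq => // x xD.
apply: contrapT => uncovered.
suff : (v < distortion (uniform_prob ab) [set` s])%E by rewrite Ds ltxx.
rewrite distortion_uniform// vE lte_pmul2l// [X in `[a, X]]bE.
apply: integral_sqdist_gt xD _ => // c cs; rewrite ltNge; apply/negP => xc.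
by apply: uncovered; exists c.
Qed.

Lemma quantization_uniform (R : realType) (a b : R) (ab : a < b) (n : nat) :
  (0 < n)%N ->
  quantization_error (uniform_prob ab) n =
    ((b - a) ^+ 2 / 12 / n%:R ^+ 2)%:E /\
  forall alpha, optimal_n_means (uniform_prob ab) n alpha <->
    alpha = [set` midpoints a ((b - a) / (2 * n%:R)) n].
Proof.
move=> n0; set m := midpoints _ _ _; set v := (_ / _ / _)%:E.
have cm : codebook n [set` m] by exact: codebook_midpoints.
have Dm : distortion (uniform_prob ab) [set` m] = v.
  by apply/(distortion_uniform_min _ _ _ _ _ _ n0 cm).2.
have qE : quantization_error (uniform_prob ab) n = v.
  apply/le_anti/andP; split.
    by apply: ereal_inf_lbound; exists [set` m].
  apply: le_ereal_inf_tmp => _ [alpha ca <-].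
  exact: (distortion_uniform_min _ _ _ _ _ _ n0 ca).1.
split=> // alpha; split=> [[ca]|->]; last by split; rewrite ?qE.
by rewrite qE => /(distortion_uniform_min _ _ _ _ _ _ n0 ca).2.
Qed.

(** The identity is not of constant sign on the whole line, so its mean is split
    into positive and negative parts; [0 <= a] makes the latter vanish on
    [[a, b]]. *)
Lemma variance_uniform (R : realType) (a b : R) (ab : a < b) : 0 <= a ->
  variance (uniform_prob ab) (fun x : measurableTypeR R => x : R) =
  ((b - a) ^+ 2 / 12)%:E.
Proof.
move=> a0.
have L0 : 0 < b - a by rewrite subr_gt0.
have t0 : 0 < (b - a) / 2 by rewrite divr_gt0.
pose c := (a + b) / 2.
have [aE bE] : a = c - (b - a) / 2 /\ b = c + (b - a) / 2 by rewrite /c; lra.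
have mean : expectation (uniform_prob ab)
    (fun x : measurableTypeR R => x : R) = c%:E.
  rewrite unlock integralE.
  rewrite integral_uniform//; last first.
    by apply: measurable_funepos; exact/measurable_EFinP.
  rewrite integral_uniform//; last first.
    by apply: measurable_funeneg; exact/measurable_EFinP.
  rewrite [X in (_ - _ * X)%E]integral0_eq; last first.
    move=> x; rewrite /= in_itv/= => /andP[ax _].
    by rewrite funenegE max_r// leeNl oppe0 lee_fin (le_trans a0).
  rewrite mule0 sube0.
  under eq_integral => x.
    rewrite inE/= in_itv/= => /andP[ax _].
    rewrite funeposE max_l ?lee_fin ?(le_trans a0)//.
    rewrite (_ : (x%:E)%E = (c + 1 * (x - c) + 0 * (x - c) ^+ 2)%:E); last first.
      by congr EFin; lra.
  over.
  rewrite [X in `[X, b]]aE [X in `[_, X]]bE integral_quadratic//.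
  by rewrite -EFinM; congr EFin; field; rewrite gt_eqF.
rewrite /variance unlock mean/= unlock integral_uniform//; first last.
- by move=> x; rewrite lee_fin sqr_ge0.
- apply/measurable_EFinP; apply: measurable_funM; exact: measurable_funB.
under eq_integral => x _.
  rewrite (_ : ((_ * _) x)%:E = (0 + 0 * (x - c) + 1 * (x - c) ^+ 2)%:E); last first.
    by congr EFin; rewrite /= !add0r mul0r add0r mul1r expr2.
over.
rewrite [X in `[X, b]]aE [X in `[_, X]]bE integral_quadratic//.
by rewrite -EFinM; congr EFin; field; rewrite gt_eqF.
Qed.

Lemma quantization_dimension1 (R : realType)
    (mu : probability (measurableTypeR R) R) (C : R) : 0 < C ->
  (forall n : nat, (0 < n)%N -> quantization_error mu n = (C / n%:R ^+ 2)%:E) ->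
  is_quantization_dimension mu 1.
Proof.
move=> C0 Vn.
pose u (n : nat) : R := 2 * ln n%:R - ln C.
have uy : u n @[n --> \oo] --> +oo.
  apply/cvgryPge => A.
  near=> n.
  have h : expR ((A + ln C) / 2) <= n%:R by near: n; exact: nbhs_infty_ger.
  have : (A + ln C) / 2 <= ln n%:R.
    rewrite -[leLHS]expRK ler_ln// ?posrE ?expR_gt0//.
    by apply: lt_le_trans h; exact: expR_gt0.
  by rewrite /u; lra.
have u0 : \forall n \near \oo, 0 < u n by move/cvgryPgt : uy; apply.
have lim1 : 1 + ln C * (u n)^-1 @[n --> \oo] --> (1 + ln C * 0 : R).
  apply: cvgD; first exact: cvg_cst.
  by apply: cvgMr; apply/gtr0_cvgV0.
rewrite mulr0 addr0 in lim1.
apply: cvg_trans lim1; apply: near_eq_cvg; near=> n.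
have n0 : (0 < n)%N by near: n; exists 1%N.
have un0 : 0 < u n by near: n.
rewrite Vn//= ln_div ?posrE ?exprn_gt0 ?ltr0n// lnXn ?ltr0n//.
have -> : - (ln C - ln n%:R *+ 2) = u n by rewrite /u; lra.
rewrite -[X in X + _](@divff _ (u n)) ?gt_eqF// -mulrDl; congr (_ / _).
by rewrite /u; lra.
Unshelve. all: by end_near.
Qed.

Theorem proposition4p5 (R : realType) :
  let nu := unif_2_5_3_5 R in
  let W : R := 1 / 300 in
  [/\ variance nu (fun x : measurableTypeR R => x : R) = W%:E,
      forall n : nat, (1 <= n)%N ->
        (forall alpha : set R, optimal_n_means nu n alpha <->
           alpha = [set 2 / 5 + (2 * i%:R - 1) / (10 * n%:R)
                   | i in [set i : nat | (1 <= i <= n)%N]]) /\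
        quantization_error nu n = (W / n%:R ^+ 2)%:E
    & is_quantization_dimension nu 1].
Proof.
move=> nu W.
have WE : ((3 / 5 - 2 / 5) ^+ 2 / 12 : R) = W by rewrite /W; lra.
have Vn n : (0 < n)%N -> quantization_error nu n = (W / n%:R ^+ 2)%:E.
  by rewrite -WE; move=> n0; exact: (quantization_uniform _ _ _ (lt_2_5_3_5 R) _ n0).1.
split.
- by rewrite -WE; apply: variance_uniform; lra.
- move=> n n0; split; last exact: Vn.
  move=> alpha; rewrite (_ : [set _ | i in _] =
      [set` midpoints (2 / 5) ((3 / 5 - 2 / 5) / (2 * n%:R)) n]).
    exact: (quantization_uniform _ _ _ (lt_2_5_3_5 R) _ n0).2.
  have n0R : n%:R != 0 :> R by rewrite pnatr_eq0 -lt0n.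
  have mE k : 2 / 5 + (2 * k.+1%:R - 1) / (10 * n%:R) =
      2 / 5 + (2 * k%:R + 1) * ((3 / 5 - 2 / 5) / (2 * n%:R)) :> R.
    by rewrite -natr1; field.
  apply/seteqP; split => [_ [[//|k] /= kn <-]|x /= /mapP[k]].
    by apply/mapP; exists k; rewrite ?mem_iota ?mE.
  by rewrite mem_iota => kn ->; exists k.+1; rewrite ?mE.
- by apply: (quantization_dimension1 _ _ W) => //; rewrite /W; lra.
Qed.
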